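(* Let $X$ be a real normed linear space, let $\Gamma$ be a weak$^*$ closed convex cone in the dual space $X^*$, and let $x^*\in X^*\setminus\Gamma$. Then there exists $x\in X$ such that $$\sup_{y^*\in\Gamma} y^*(x)=0<x^*(x).$$
   Context: All linear spaces are real. $X^*$ is the space of continuous linear functionals on $X$. Convex cones are closed under addition and under multiplication by nonnegative scalars, and contain $0$. *)

(* Defs.v *)
From HB Require Import structures.
From mathcomp Require Import all_boot all_order all_algebra.
From mathcomp Require Import all_classical all_reals all_analysis.

Set Implicit Arguments.
Unset Strict Implicit.
Unset Printing Implicit Defensive.

Import Order.TTheory GRing.Theory Num.Theory.
Import numFieldNormedType.Exports.

Local Open Scope classical_set_scope.
Local Open Scope ring_scope.

Definition continuous_linear (R : realType) (X : normedModType R)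
    : {pred X -> R^o} :=
  mem [set f : X -> R^o | linear f /\ continuous f].
Arguments continuous_linear {R} X.

Record dual (R : realType) (X : normedModType R) : Type := Dual {
  dual_fun :> X -> R^o ;
  dual_funP : dual_fun \in continuous_linear X }.

HB.instance Definition _ (R : realType) (X : normedModType R) :=
  [isSub for @dual_fun R X].
HB.instance Definition _ (R : realType) (X : normedModType R) :=
  [Choice of dual X by <:].

Lemma continuous_linear_submod_closed (R : realType) (X : normedModType R) :
  submod_closed (continuous_linear X).
Proof.
split.
  rewrite inE /=; split; last by move=> x; exact: cvg_cst.
  by move=> a u v; rewrite /= scaler0 addr0.
move=> a f g; rewrite !inE /= => -[lf cf] [lg cg]; split.
  move=> b u v; rewrite !fctE lf lg !scalerDr !scalerA (mulrC a b).
  by rewrite addrACA.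
by move=> x; apply: cvgD; [apply: cvgZr; exact: cf|exact: cg].
Qed.

HB.instance Definition _ (R : realType) (X : normedModType R) :=
  GRing.isSubmodClosed.Build R (X -> R^o) (continuous_linear X)
    (@continuous_linear_submod_closed R X).
HB.instance Definition _ (R : realType) (X : normedModType R) :=
  [SubChoice_isSubLmodule of dual X by <:].

(* The coarsest topology on the dual for which the evaluation at every x : X
   is continuous; [dual X] itself carries no topology. *)
Definition weak_star (R : realType) (X : normedModType R) : topologicalType :=
  sup_topology (fun x : X =>
    Topological.on (initial_topology (fun f : dual X => f x))).

Lemma weak_star_cvgE (R : realType) (X : normedModType R)
    (F : set_system (dual X)) (f : dual X) : Filter F ->
  F --> (f : weak_star X) <->
  forall x : X, (fun g : dual X => g x) @ F --> f x.
Proof.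
move=> FF; split.
  move=> /cvg_sup + x => /(_ x) Fx.
  move=> A fA; apply: Fx.
  exact: (@initial_continuous (dual X) R^o (fun g : dual X => g x) f A fA).
move=> Ff; apply/cvg_sup => x A.
rewrite /= (@nbhsE (initial_topology (fun g : dual X => g x))).
case=> B [[C oC <-] Cf] BA; apply: filterS BA _; apply: (Ff x).
exact: open_nbhs_nbhs.
Qed.

Definition convex_cone (R : realType) (V : lmodType R) (C : set V) : Prop :=
  [/\ C 0,
      forall u v, C u -> C v -> C (u + v) &
      forall (a : R) u, 0 <= a -> C u -> C (a *: u)].

(* Main.v *)
Require Import Defs.
From HB Require Import structures.
From mathcomp Require Import all_boot all_order all_algebra.
From mathcomp Require Import all_classical all_reals all_analysis.
From mathcomp Require Import ring lra.

Set Implicit Arguments.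
Unset Strict Implicit.
Unset Printing Implicit Defensive.

Import Order.TTheory GRing.Theory Num.Theory.
Import numFieldNormedType.Exports.

Local Open Scope classical_set_scope.
Local Open Scope ring_scope.

(** A weak* neighbourhood of [xs] only constrains finitely many evaluations:
    since [Gamma] is weak* closed and misses [xs], there are points
    x_1, ..., x_n of [X] and e > 0 such that no element of [Gamma] is e-close
    to [xs] at every x_i ([weak_star_nbhs_finite]).  Evaluation at the x_i is a
    linear map T from the dual to R^n; it sends [Gamma] to a convex cone whose
    closure does not contain T xs.  The problem thus becomes the separation of a
    point from a cone in R^n ([convex_cone_separation]): there is a vector c
    such that c.y <= 0 on the cone and c.(T xs) > 0.  Because
    c.(T g) = g (sum_i c_i x_i), the vector sum_i c_i x_i of [X] is the wanted
    point.  The supremum is exactly 0 because [Gamma] contains 0.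

    In R^n the separating vector is p - y0, where y0 is a point of the
    closure of the cone nearest to p for the Euclidean distance.  It exists by
    compactness ([nearest_point_closure]); comparing y0 with y0 + t y and with
    (1 - t) y0 for small t > 0 gives c.y <= 0 and c.y0 >= 0, whence
    c.p >= c.c > 0. *)

Definition dot (R : realType) n (u v : 'rV[R]_n) : R :=
  \sum_(i < n) u ord0 i * v ord0 i.

Lemma dotDr (R : realType) n (u v w : 'rV[R]_n) :
  dot u (v + w) = dot u v + dot u w.
Proof.
by rewrite -big_split; apply: eq_bigr => i _; rewrite mxE mulrDr.
Qed.

Lemma dotZr (R : realType) n a (u v : 'rV[R]_n) :
  dot u (a *: v) = a * dot u v.
Proof.
by rewrite big_distrr; apply: eq_bigr => i _; rewrite mxE mulrCA.
Qed.

Lemma dotC (R : realType) n (u v : 'rV[R]_n) : dot u v = dot v u.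
Proof. by apply: eq_bigr => i _; rewrite mulrC. Qed.

Lemma dot_sqrD (R : realType) n (u v : 'rV[R]_n) a :
  dot (u + a *: v) (u + a *: v) = dot u u + 2 * a * dot u v + a ^+ 2 * dot v v.
Proof.
rewrite dotDr dotZr ![dot (_ + _) _]dotC !dotDr !dotZr (dotC v u).
by ring.
Qed.

(** The norm on row vectors is the sup norm, so the Euclidean quantities below
    have to be compared with it to get boundedness and definiteness. *)
Lemma norm_sqr_le_dot (R : realType) n (v : 'rV[R]_n) : `|v| ^+ 2 <= dot v v.
Proof.
have [->|v0] := eqVneq `|v| 0.
  by rewrite expr0n sumr_ge0// => i _; rewrite -expr2 sqr_ge0.
have [[i j] /= vE] := mx_norm_neq0 v0.
have {vE}-> : `|v| = `|v ord0 j| by rewrite [LHS]vE ord1.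
rewrite -normrX ger0_norm ?sqr_ge0// /dot (bigD1 j)//= -expr2 lerDl.
by rewrite sumr_ge0// => k _; rewrite -expr2 sqr_ge0.
Qed.

Lemma continuous_dot_sub (R : realType) n (p : 'rV[R]_n) :
  continuous (fun y : 'rV[R]_n => dot (p - y) (p - y)).
Proof.
have cc i : continuous (fun y : 'rV[R]_n => (p - y) ord0 i).
  have -> : (fun y => (p - y) ord0 i) = (fun y => p ord0 i - y ord0 i).
    by apply/funext => y; rewrite !mxE.
  move=> y; apply: (@continuousB _ R^o); first exact: cst_continuous.
  exact: coord_continuous.
apply: continuous_big => [|i _ y]; first exact: (@add_continuous R^o).
by apply: continuousM; exact: cc.
Qed.

(** First-order optimality: dividing the variation of a quadratic function
    along a ray by the step [t] leaves an inequality of this form. *)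
Lemma le0_of_small (R : realType) (b q : R) :
  (forall t, 0 < t -> t < 1 -> b <= t * q) -> b <= 0.
Proof.
move=> H; rewrite leNgt; apply/negP => b0.
(* this step lies in ]0, 1[ and makes t * q < b when b > 0 *)
have := H (b / (b + `|q| + 1)).
have q0 := normr_ge0 q.
have d0 : 0 < b + `|q| + 1 by lra.
rewrite divr_gt0// ltr_pdivrMr// mul1r mulrAC ler_pdivlMr//.
have := ler_norm q; move: `|q| q0 d0 => r r0 d0 qr.
have -> : b < b + r + 1 by lra.
move=> /(_ isT isT); nra.
Qed.

Lemma closure_stable (T : topologicalType) (f : T -> T) (C : set T) :
  continuous f -> (forall y, C y -> C (f y)) ->
  forall y, closure C y -> closure C (f y).
Proof.
move=> cf Cf y; rewrite [X in X _ -> _]closureE => /(_ (f @^-1` closure C)); apply.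
split=> [|z Cz]; last exact/subset_closure/Cf.
by move/continuous_closedP : cf; apply; exact: closed_closure.
Qed.

Lemma closure_addr (R : realType) (V : normedModType R) (C : set V) (v : V) :
  (forall y, C y -> C (y + v)) -> forall y, closure C y -> closure C (y + v).
Proof.
apply: (@closure_stable V (fun y => y + v)) => y.
by apply: cvgD; [exact: cvg_id|exact: cvg_cst].
Qed.

Lemma closure_scale (R : realType) (V : normedModType R) (C : set V) (a : R) :
  (forall y, C y -> C (a *: y)) -> forall y, closure C y -> closure C (a *: y).
Proof.
by apply: (@closure_stable V (fun y => a *: y)) => y; apply: cvgZr; exact: cvg_id.
Qed.

(** Only the points at least as close to [p] as a chosen [z] in [C] compete, and
    in the closure they form a bounded closed set, hence a compact one. *)
Lemma nearest_point_closure (R : realType) n (C : set 'rV[R]_n) p :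
  C !=set0 -> exists2 y0, closure C y0 &
    forall y, closure C y -> dot (p - y0) (p - y0) <= dot (p - y) (p - y).
Proof.
move=> [z Cz]; set q := fun y => dot (p - y) (p - y).
pose K := closure C `&` [set y | q y <= q z].
have Kz : K z by split; [exact: subset_closure|rewrite /= lexx].
have cK : closed K.
  apply: closedI; first exact: closed_closure.
  have /continuous_closedP := @continuous_dot_sub R n p.
  by move=> /(_ _ (@closed_le R (q z))).
have bK : bounded_set K.
  (* `|p - y| ^+ 2 <= q z implies `|p - y| <= 1 + q z *)
  exists (`|p| + 1 + q z); split; first by rewrite num_real.
  move=> M MM y [_ /= qy]; apply: le_trans (ltW MM).
  have := norm_sqr_le_dot (p - y); rewrite -/(q y) => /le_trans /(_ qy).
  have : `|y| <= `|p| + `|p - y|.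
    by rewrite -[in X in X <= _](subKr p y) (le_trans (ler_normB _ _)).
  have := normr_ge0 (p - y).
  move: `|p - y| (q z) => r s r0 yr rs; nra.
have [||y0 /[!inE] -[Cy0 y0z] y0min] :=
    @EVT_min_rV R n q K _ (bounded_closed_compact bK cK) _.
- by exists z.
- by apply: continuous_subspaceT; exact: continuous_dot_sub.
exists y0 => // y Cy; have [yz|/ltW zy] := leP (q y) (q z).
  by apply: y0min; rewrite inE.
exact: le_trans y0z zy.
Qed.

(** The vector [c] points from the nearest point [y0] of the closure to [p].
    Moving [y0] inside the closure, by adding a multiple of an element of the
    cone or by shrinking [y0], cannot bring it closer to [p]. *)
Lemma convex_cone_separation (R : realType) n (C : set 'rV[R]_n) p :
  convex_cone C -> ~ closure C p ->
  exists c, (forall y, C y -> dot c y <= 0) /\ 0 < dot c p.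
Proof.
move=> [C0 CD CZ] nCp.
have [|y0 Cy0 y0min] := @nearest_point_closure R n C p; first by exists 0.
set c := p - y0 in y0min.
have ray v t : closure C (y0 - t *: v) -> 0 <= 2 * t * dot c v + t ^+ 2 * dot v v.
  move=> /y0min; rewrite opprB addrCA addrC -/c dot_sqrD; lra.
have cy y : C y -> dot c y <= 0.
  move=> Cy; suff : 2 * dot c y <= 0 by lra.
  apply: (@le0_of_small _ _ (dot y y)) => t t0 _.
  have /ray : closure C (y0 - t *: (-1 *: y)).
    rewrite scaleN1r scalerN opprK.
    apply: (@closure_addr R 'rV[R]_n) => // z Cz.
    by apply: CD => //; apply: CZ => //; exact: ltW.
  rewrite !dotZr (dotC (_ *: _)) !dotZr => H.
  by rewrite -(ler_pM2l t0); lra.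
exists c; split=> //.
have cy0 : - (2 * dot c y0) <= 0.
  apply: (@le0_of_small _ _ (dot y0 y0)) => t t0 t1.
  rewrite -(ler_pM2l t0).
  suff : 0 <= 2 * t * dot c y0 + t ^+ 2 * dot y0 y0 by lra.
  apply: ray; rewrite -[X in X - _]scale1r -scalerBl.
  apply: (@closure_scale R 'rV[R]_n) => // z Cz.
  by apply: CZ => //; lra.
have -> : p = c + y0 by rewrite subrK.
have : 0 < dot c c.
  apply: lt_le_trans (norm_sqr_le_dot c).
  rewrite exprn_gt0// normr_gt0; apply/eqP => /subr0_eq pE.
  by apply: nCp; rewrite pE.
rewrite dotDr; lra.
Qed.

(** The sets [A] satisfying the conclusion form a filter, which converges to [f]
    at each point of [X] and therefore in the weak* topology: it contains every
    weak* neighbourhood. *)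
Lemma weak_star_nbhs_finite (R : realType) (X : normedModType R)
    (f : dual X) (A : set (weak_star X)) :
  nbhs (f : weak_star X) A ->
  exists (s : seq X) (e : R), 0 < e /\
    forall g : dual X, (forall x, x \in s -> `|f x - g x| < e) -> A g.
Proof.
pose F : set_system (dual X) := [set B | exists (s : seq X) (e : R), 0 < e /\
    forall g : dual X, (forall x, x \in s -> `|f x - g x| < e) -> B g].
have FF : Filter F.
  split.
  - by exists [::], 1.
  - move=> B D [s [e [e0 sB]]] [s' [e' [e'0 sD]]].
    exists (s ++ s'), (Num.min e e'); split; first by rewrite lt_min e0.
    move=> g sg; split; [apply: sB|apply: sD] => x xs.
      by have := sg x; rewrite mem_cat xs lt_min => /(_ isT) /andP[].
    by have := sg x; rewrite mem_cat xs orbT lt_min => /(_ isT) /andP[].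
  - move=> B D BD [s [e [e0 sB]]]; exists s, e; split=> // g /sB; exact: BD.
suff : F --> (f : weak_star X) by apply.
apply/weak_star_cvgE => x B /nbhs_ballP[e /= e0 eB].
exists [:: x], e; split=> // g xg; apply: eB; apply: xg.
by rewrite inE.
Qed.

Lemma dual_linear (R : realType) (X : normedModType R) (f : dual X) : linear f.
Proof. by have := dual_funP f; rewrite inE => -[]. Qed.

Lemma dual_sum (R : realType) (X : normedModType R) (f : dual X) n
    (c : 'I_n -> R) (x : 'I_n -> X) :
  f (\sum_i c i *: x i) = \sum_i c i * f (x i).
Proof.
pose L := GRing.isLinear.Build R X R^o *:%R f (dual_linear f).
pose g : {linear X -> R^o} := HB.pack (f : X -> R^o) L.
have -> : f = g :> (X -> R^o) by [].
by rewrite linear_sum; apply: eq_bigr => i _; rewrite linearZ.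
Qed.

(** Pushing [Gamma] forward to R^n along the evaluations at the points of [s]
    reduces the separation to [convex_cone_separation]. *)
Lemma dual_separation (R : realType) (X : normedModType R)
    (Gamma : set (dual X)) (f : dual X) :
  convex_cone Gamma -> closed (Gamma : set (weak_star X)) -> ~ Gamma f ->
  exists x : X, (forall g, Gamma g -> g x <= 0 :> R) /\ 0 < (f x : R).
Proof.
move=> [G0 GD GZ] Gcl Gf.
have [s [e [e0 sG]]] : exists (s : seq X) (e : R), 0 < e /\
    forall g : dual X, (forall x, x \in s -> `|f x - g x| < e) -> ~ Gamma g.
  apply: weak_star_nbhs_finite; apply: open_nbhs_nbhs; split=> //.
  exact: closed_openC.
pose T (g : dual X) : 'rV[R]_(size s) := \row_i g s`_i.
have TE (c : 'rV[R]_(size s)) g : dot c (T g) = g (\sum_i c ord0 i *: s`_i).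
  by rewrite dual_sum; apply: eq_bigr => i _; rewrite mxE.
have [|fT|c [cG cf]] := @convex_cone_separation R _ (T @` Gamma) (T f).
- split.
  + by exists 0 => //; apply/rowP => i; rewrite !mxE.
  + move=> _ _ [u Gu <-] [v Gv <-]; exists (u + v); first exact: GD.
    by apply/rowP => i; rewrite !mxE.
  + move=> a _ a0 [u Gu <-]; exists (a *: u); first exact: GZ.
    by apply/rowP => i; rewrite !mxE.
- have [_ [[g Gg <-]]] := fT _ (nbhsx_ballx (T f) e e0).
  case=> _ fg; apply: (sG g) => // x xs.
  have xi : (index x s < size s)%N by rewrite index_mem.
  by have := fg ord0 (Ordinal xi); rewrite !mxE /= nth_index.
- exists (\sum_i c ord0 i *: s`_i); split=> [g Gg|]; last by rewrite -TE.
  by rewrite -TE; apply: cG; exists g.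
Qed.

Theorem theorem2p2 (R : realType) (X : normedModType R) (Gamma : set (dual X))
    (Gamma_cone : convex_cone Gamma)
    (Gamma_closed : closed (Gamma : set (weak_star X)))
    (xs : dual X) (xs_notin : ~ Gamma xs) :
  exists x : X,
    ereal_sup [set (ys x : R)%:E | ys in Gamma] = 0%:E /\ 0 < (xs x : R).
Proof.
have [x [Gx fx]] := dual_separation Gamma_cone Gamma_closed xs_notin.
exists x; split=> //; apply/eqP; rewrite eq_le; apply/andP; split.
  by apply: ge_ereal_sup => _ [g Gg <-]; rewrite lee_fin Gx.
by apply: ereal_sup_ubound; case: Gamma_cone => G0 _ _; exists 0.
Qed.
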